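(* Let $\preceq$ be an admissible order on $L_n([0,1])$, let $\omega=(w_1,\ldots,w_m)$ be a weighting vector, and let $\mathcal{L}'_n([0,1])=\langle L_n([0,1]),+,\star,\preceq\rangle$ be an ordered semi-vector space over $U$ (with vector addition $+$ and scalar multiplication $\star$). Then the function $\mathcal{M}_\omega^{\mathcal{L}'_n([0,1])}:L_n([0,1])^m\to L_n([0,1])$ defined by $$\mathcal{M}_\omega^{\mathcal{L}'_n([0,1])}(\mathbf{x}_1,\ldots,\mathbf{x}_m)=\sum_{j=1}^m w_j\star\mathbf{x}_{j},$$ where the sum is with respect to $+$, is an idempotent $m$-ary $n$-dimensional aggregation function with respect to $\preceq$.
   Context: $L_n([0,1])=\{(x_1,\ldots,x_n)\in[0,1]^n : x_1\leq\cdots\leq x_n\}$. The product order on $L_n([0,1])$ is: $\mathbf{x}\leq_n^p\mathbf{y}$ iff $x_i\leq y_i$ for all $i$. A total order $\preceq$ on $L_n([0,1])$ is admissible if $\mathbf{x}\leq_n^p\mathbf{y}$ implies $\mathbf{x}\preceq\mathbf{y}$. For $x\in[0,1]$, $/x/=(x,\ldots,x)\in L_n([0,1])$. A weighting vector is $\omega=(w_1,\ldots,w_m)\in[0,1]^m$ with $\sum_{i=1}^m w_i=1$. $U=\langle[0,1],\dotplus,\cdot\rangle$, where $\cdot$ is the usual multiplication and $r\dotplus s=\min(1,r+s)$; the paper treats $U$ as a weak semifield (an algebra with associative commutative operations $\boxplus,\cdot$, with $\cdot$ distributive over $\boxplus$, an additive identity $0$ and a multiplicative identity $1$). An ordered semi-vector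 space over $U$ with underlying set $V$, operations $+:V\times V\to V$, $\star:[0,1]\times V\to V$, and partial order $\leq$ on $V$ is one satisfying, for all $x,y,z\in V$, $r,s\in[0,1]$: (SV1) $x+(y+z)=(x+y)+z$; (SV2) $x+y=y+x$; (SV3) $r\star(s\star x)=(r\cdot s)\star x$; (SV4) $1\star x=x$; (SV5) $r\star(x+y)=(r\star x)+(r\star y)$; (SV6) $(r\dotplus s)\star x=(r\star x)+(s\star x)$; (SV7) there is $\mathbf{0}\in V$ with $\mathbf{0}+x=x$ for all $x\in V$; (SV8) $x\leq y$ implies $r\star x\leq r\star y$; (SV9) $x\leq y$ implies $x+z\leq y+z$. A function $\mathcal{A}:L_n([0,1])^m\to L_n([0,1])$ is an $m$-ary $n$-dimensional aggregation function with respect to $\preceq$ if $\mathcal{A}(/0/,\ldots,/0/)=/0/$, $\mathcal{A}(/1/,\ldots,/1/)=/1/$, and $\mathcal{A}(\mathbf{x}_1,\ldots,\mathbf{x}_m)\preceq\mathcal{A}(\mathbf{y}_1,\ldots,\mathbf{y}_m)$ whenever $\mathbf{x}_j\preceq\mathbf{y}_j$ for each $j\in\{1,\ldots,m\}$. It is idempotent if $\mathcal{A}(\mathbf{x},\ldots,\mathbf{x})=\mathbf{x}$ for each $\mathbf{x}\in L_n([0,1])$. *)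

(* Defs.v *)
From HB Require Import structures.
From mathcomp Require Import all_boot all_order all_algebra.
From mathcomp Require Import interval_inference.
From mathcomp Require Import reals.

Set Implicit Arguments.
Unset Strict Implicit.
Unset Printing Implicit Defensive.

Import Order.TTheory GRing.Theory Num.Theory.
Local Open Scope ring_scope.

(* L_n([0,1]): the nondecreasing n-tuples over [0,1] = {i01 R}. *)
Record Ln (R : realType) (n : nat) := MkLn {
  Ln_val :> n.-tuple {i01 R};
  Ln_sorted : sorted <=%O Ln_val }.

HB.instance Definition _ (R : realType) (n : nat) := [isSub for @Ln_val R n].
HB.instance Definition _ (R : realType) (n : nat) := [Choice of Ln R n by <:].

Lemma sorted_diag (R : realType) (n : nat) (a : {i01 R}) :
  sorted <=%O (nseq_tuple n a).
Proof. by case: n => //= n; elim: n => //= n ->; rewrite lexx. Qed.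

(* /a/ = (a, ..., a) *)
Definition diag (R : realType) (n : nat) (a : {i01 R}) : Ln R n :=
  MkLn (sorted_diag n a).

Definition prod_le (R : realType) (n : nat) (x y : Ln R n) : Prop :=
  forall i : 'I_n, tnth x i <= tnth y i.

Record partial_order (V : Type) (le : rel V) : Prop := PartialOrder {
  po_refl : reflexive le;
  po_anti : antisymmetric le;
  po_trans : transitive le }.

Record admissible (R : realType) (n : nat) (le : rel (Ln R n)) : Prop :=
  Admissible {
    adm_order : partial_order le;
    adm_total : total le;
    adm_refine : forall x y : Ln R n, prod_le x y -> le x y }.

Definition weighting_vector (R : realType) (m : nat) (w : m.-tuple {i01 R}) :
  Prop := \sum_(j < m) (tnth w j)%:num = 1 :> R.

(* The operations of U, as operations on [0,1]. *)
Definition Uadd (R : realType) (r s : {i01 R}) : {i01 R} :=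
  (Num.min 1 (r%:num + s%:num))%:i01.

Definition Umul (R : realType) (r s : {i01 R}) : {i01 R} :=
  (r%:num * s%:num)%:i01.

(* The zero vector is a parameter, so that sums of vectors can be written as big
   operators; sv2 and sv7 determine it uniquely. *)
Record ordered_semi_vector_space (R : realType) (V : Type)
    (zero : V) (add : V -> V -> V) (scale : {i01 R} -> V -> V) (le : rel V) :
    Prop := OrderedSemiVectorSpace {
  sv_order : partial_order le;
  sv1 : forall x y z : V, add x (add y z) = add (add x y) z;
  sv2 : forall x y : V, add x y = add y x;
  sv3 : forall (r s : {i01 R}) (x : V), scale r (scale s x) = scale (Umul r s) x;
  sv4 : forall x : V, scale 1%:i01 x = x;
  sv5 : forall (r : {i01 R}) (x y : V),
    scale r (add x y) = add (scale r x) (scale r y);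
  sv6 : forall (r s : {i01 R}) (x : V),
    scale (Uadd r s) x = add (scale r x) (scale s x);
  sv7 : forall x : V, add zero x = x;
  sv8 : forall (r : {i01 R}) (x y : V), le x y -> le (scale r x) (scale r y);
  sv9 : forall x y z : V, le x y -> le (add x z) (add y z) }.

Record aggregation_function (R : realType) (m n : nat) (le : rel (Ln R n))
    (A : m.-tuple (Ln R n) -> Ln R n) : Prop := AggregationFunction {
  agg0 : A (nseq_tuple m (diag n 0%:i01)) = diag n 0%:i01;
  agg1 : A (nseq_tuple m (diag n 1%:i01)) = diag n 1%:i01;
  agg_mono : forall x y : m.-tuple (Ln R n),
    (forall j : 'I_m, le (tnth x j) (tnth y j)) -> le (A x) (A y) }.

Definition idempotent_agg (R : realType) (m n : nat)
    (A : m.-tuple (Ln R n) -> Ln R n) : Prop :=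
  forall x : Ln R n, A (nseq_tuple m x) = x.

Definition weighted_mean (R : realType) (m n : nat) (w : m.-tuple {i01 R})
    (zero : Ln R n) (add : Ln R n -> Ln R n -> Ln R n)
    (scale : {i01 R} -> Ln R n -> Ln R n) (x : m.-tuple (Ln R n)) : Ln R n :=
  \big[add/zero]_(j < m) scale (tnth w j) (tnth x j).

(* Main.v *)
Require Import Defs.
From mathcomp Require Import all_boot all_order all_algebra.
From mathcomp Require Import interval_inference reals.

(** By (SV6) the sum of the [w_j * x] is [(w_1 + ... + w_m) * x = 1 * x = x],
    which is idempotence; the two boundary conditions are its cases [/0/] and
    [/1/]. Monotonicity holds term by term by (SV8), and the terms are summed
    with (SV9).

    Two points in the first argument need care. The addition of scalars is
    truncated at [1], but truncating at each step or only at the end gives the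
    same scalar ([min1_addl]). And the axioms do not give [0 * x = 0]: with
    [r * x = x] for all [r] and the maximum of the total order as addition,
    they all hold. So the sum of scaled copies of [x] cannot be computed starting
    from the empty sum; it is computed from its first term [w_1 * x]
    ([scale_add_sum]), which exists since weights with sum [1] are not an empty
    family. *)

Set Implicit Arguments.
Unset Strict Implicit.
Unset Printing Implicit Defensive.

Import Order.TTheory GRing.Theory Num.Theory.
Local Open Scope ring_scope.

(** The inner truncation changes [a] only when [1 <= a], and then both sides are
    [1] because [0 <= b]. *)
Lemma min1_addl (R : realDomainType) (a b : R) : 0 <= b ->
  Num.min 1 (Num.min 1 a + b) = Num.min 1 (a + b).
Proof.
move=> b0; have [a1|a1] := leP 1 a => //.
by rewrite !min_l // ?lerDl // (le_trans a1) ?lerDl.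
Qed.

Section OrderedSemiVectorSpace.
Variables (R : realType) (V : Type) (zero : V) (add : V -> V -> V).
Variables (scale : {i01 R} -> V -> V) (le : rel V).
Hypothesis svV : ordered_semi_vector_space zero add scale le.

(** The leading term [scale r x] makes the statement true even for an empty
    sum, where [zero] and [scale 0 x] could differ. *)
Lemma scale_add_sum (I : Type) (s : seq I) (c : I -> {i01 R}) (x : V)
    (r t : {i01 R}) :
  t%:num = Num.min 1 (r%:num + \sum_(i <- s) (c i)%:num) ->
  add (scale r x) (\big[add/zero]_(i <- s) scale (c i) x) = scale t x.
Proof.
elim: s r => [|i s IHs] r.
  rewrite !big_nil addr0 min_r ?le1 // => /val_inj ->.
  by rewrite (sv2 svV) (sv7 svV).
rewrite !big_cons => tE.
rewrite (sv1 svV) -(sv6 svV) IHs // tE /= min1_addl ?addrA //.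
by apply: sumr_ge0 => j _; exact: ge0.
Qed.

Lemma le_sum_vectors (I : Type) (s : seq I) (f g : I -> V) :
  (forall i, le (f i) (g i)) ->
  le (\big[add/zero]_(i <- s) f i) (\big[add/zero]_(i <- s) g i).
Proof.
case: (sv_order svV) => refl _ trans fg.
elim/big_rec2: _ => [|i z y _ yz]; first exact: refl.
apply: (trans (add (g i) y)); first exact: (sv9 svV).
by rewrite !(sv2 svV (g i)); exact: (sv9 svV).
Qed.

End OrderedSemiVectorSpace.

Theorem theorem3 (R : realType) (m n : nat) (le : rel (Ln R n))
    (w : m.-tuple {i01 R})
    (zero : Ln R n) (add : Ln R n -> Ln R n -> Ln R n)
    (scale : {i01 R} -> Ln R n -> Ln R n) :
  admissible le ->
  weighting_vector w ->
  ordered_semi_vector_space zero add scale le ->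
  aggregation_function le (weighted_mean w zero add scale) /\
  idempotent_agg (weighted_mean w zero add scale).
Proof.
move=> _ w1 svL.
have idem : idempotent_agg (weighted_mean w zero add scale).
  move=> x; rewrite /weighted_mean.
  under eq_bigr do rewrite tnth_nseq.
  case: m w w1 => [|k] w; rewrite /weighting_vector.
    by rewrite big_ord0 => /esym/eqP; rewrite oner_eq0.
  rewrite !big_ord_recl => w1.
  rewrite (scale_add_sum svL x (t := 1%:i01)) ?(sv4 svL) //.
  by rewrite w1 minxx.
split=> //; split; [exact: idem | exact: idem |].
move=> x y xy; apply: (le_sum_vectors svL) => j.
exact: (sv8 svL).
Qed.
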